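(* Let $\Gamma$ be a digraph with vertex set $\{1,\dots,n\}$, $n>1$, and let $S=(s_{ij})_{n\times n}$ determine a transitional measure for $\Gamma$ and have positive off-diagonal entries. Let $H=(h_{ij})$ be the matrix with $h_{ij}=\ln s_{ij}$ (entrywise natural logarithm), and let $D=(d_{ij})$ be given by $d_{ij}=\tfrac12(h_{ii}+h_{jj}-h_{ij}-h_{ji})=\tfrac12\ln\frac{s_{ii}s_{jj}}{s_{ij}s_{ji}}$. Then $D$ is a matrix of distances (a metric) on $\{1,\dots,n\}$: $d_{ij}=0$ if and only if $i=j$, and $d_{ij}+d_{jk}\ge d_{ki}$ for all $i,j,k$ (hence also $D$ is symmetric and nonnegative).
   Context: A digraph $\Gamma$ here is a weighted directed multigraph without loops, with vertex set $\{1,\dots,n\}$, $n>1$; each arc has a positive weight. A directed path from $v_0$ to $v_k$ is an alternating sequence $v_0,a_1,v_1,\dots,a_k,v_k$ of vertices and arcs in which all vertices are distinct and each $a_i$ is an arc from $v_{i-1}$ to $v_i$; for each vertex $v_0$ the sequence $v_0$ (length $0$) is the unique path from $v_0$ to $v_0$. $S$ satisfies the transition inequality if $s_{ij}s_{jk}\le s_{ik}s_{jj}$ for all $i,j,k$; it satisfies the graph bottleneck identity w.r.t. $\Gamma$ if for all $i,j,k$: $s_{ij}s_{jk}=s_{ik}s_{jj}$ holds if and only if every directed path in $\Gamma$ from $i$ to $k$ contains $j$. $S$ determines a transitional measure for $\Gamma$ if it satisfies both.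
   Formalization: For n = 2 the hypotheses allow negative s_ii, so ln s_ii may be undefined: D is therefore taken as the quotient formula, proved a metric in all cases, and shown equal to the formula in h_ij with the added assumption s_ii > 0 when n = 2 (for n > 2 it is automatic). *)

(* Defs.v *)
From mathcomp Require Import all_boot all_order all_algebra.
From mathcomp Require Import reals exp.

Set Implicit Arguments.
Unset Strict Implicit.
Unset Printing Implicit Defensive.

Import Order.TTheory GRing.Theory Num.Theory.
Local Open Scope ring_scope.

(* Parallel arcs are allowed: arcs form a type of their own. *)
Record digraph (R : realType) (n : nat) := Digraph {
  arc : Type;
  src : arc -> 'I_n;
  tgt : arc -> 'I_n;
  weight : arc -> R;
  src_neq_tgt : forall a, src a != tgt a;
  weight_gt0 : forall a, 0 < weight a
}.

Section Paths.
Variables (R : realType) (n : nat) (G : digraph R n).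

(* The alternating sequence v_0, a_1, v_1, ..., a_m, v_m is represented by v_0
   together with the list [:: (a_1, v_1); ...; (a_m, v_m)]. *)
Fixpoint alternating (v : 'I_n) (p : seq (arc G * 'I_n)) : bool :=
  if p is (a, w) :: p' then [&& src a == v, tgt a == w & alternating w p']
  else true.

Definition vertices (v : 'I_n) (p : seq (arc G * 'I_n)) : seq 'I_n :=
  v :: [seq x.2 | x <- p].

Definition directed_path (i k : 'I_n) (p : seq (arc G * 'I_n)) : bool :=
  [&& alternating i p, uniq (vertices i p) & last i (vertices i p) == k].

Definition every_path_contains (i j k : 'I_n) : Prop :=
  forall p, directed_path i k p -> j \in vertices i p.

End Paths.

Section TransitionalMeasures.
Variables (R : realType) (n : nat).

Definition transition_inequality (S : 'M[R]_n) : Prop :=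
  forall i j k, S i j * S j k <= S i k * S j j.

Definition graph_bottleneck_identity (G : digraph R n) (S : 'M[R]_n) : Prop :=
  forall i j k, S i j * S j k = S i k * S j j <-> every_path_contains G i j k.

Definition transitional_measure (G : digraph R n) (S : 'M[R]_n) : Prop :=
  transition_inequality S /\ graph_bottleneck_identity G S.

Definition distance_matrix (D : 'M[R]_n) : Prop :=
  [/\ forall i j, D i j = 0 <-> i = j,
      forall i j k, D i j + D j k >= D k i,
      forall i j, D i j = D j i
    & forall i j, 0 <= D i j].

End TransitionalMeasures.

(* Main.v *)
(* The bound s_ij s_ji <= s_ii s_jj makes q_ij = s_ii s_jj / (s_ij s_ji) at least 1, and the bottleneck identity makes it strict for i != j, because the path of length 0 from i to i avoids j. Multiplying the transition inequalities for (i, j, k) and (k, j, i) gives q_ki <= q_ij q_jk; take logarithms. *)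

Require Import Defs.
From mathcomp Require Import all_boot all_order all_algebra.
From mathcomp Require Import reals exp.
From mathcomp Require Import ring.

Set Implicit Arguments.
Unset Strict Implicit.
Unset Printing Implicit Defensive.

Import Order.TTheory GRing.Theory Num.Theory.
Local Open Scope ring_scope.

Section TransitionInequality.
Variables (R : realType) (n : nat) (S : 'M[R]_n).
Hypothesis S_trans : transition_inequality S.
Hypothesis S_offdiag_gt0 : forall i j : 'I_n, i != j -> 0 < S i j.

Definition cross_ratio (i j : 'I_n) : R := S i i * S j j / (S i j * S j i).

Lemma cross_ratioC i j : cross_ratio i j = cross_ratio j i.
Proof. by rewrite /cross_ratio (mulrC (S i i)) (mulrC (S i j)). Qed.

Lemma offdiag_mul_gt0 i j : i != j -> 0 < S i j * S j i.
Proof. by move=> ij; rewrite mulr_gt0 ?S_offdiag_gt0 // eq_sym. Qed.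

(** Some [j] differs from [i], and [0 < s_ij s_ji <= s_ii s_jj] rules out [s_ii = 0] but leaves its
    sign open. *)
Lemma diag_neq0 i : (1 < n)%N -> S i i != 0.
Proof.
move=> n_gt1.
have /card_gt0P[j] : (0 < #|[set~ i]|)%N by rewrite cardsC1 card_ord -subn1 subn_gt0.
rewrite !inE eq_sym => ij.
have : 0 < S i i * S j j := lt_le_trans (offdiag_mul_gt0 ij) (S_trans i j i).
by apply: contraTneq => ->; rewrite mul0r ltxx.
Qed.

Lemma cross_ratio_diag i : (1 < n)%N -> cross_ratio i i = 1.
Proof. by move=> n_gt1; rewrite /cross_ratio divff // mulf_neq0 ?diag_neq0. Qed.

(** A third index makes the sign visible: for distinct [i], [j], [k], [0 < s_ij s_jk <= s_ik s_jj]
    with [s_ik > 0]. *)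
Lemma diag_gt0 j : (2 < n)%N -> 0 < S j j.
Proof.
move=> n_gt2.
have /card_gt1P[i [k []]] : (1 < #|[set~ j]|)%N.
  by rewrite cardsC1 card_ord -ltnS prednK // (ltn_trans _ n_gt2).
rewrite !inE => ij kj ik.
rewrite -(pmulr_rgt0 _ (S_offdiag_gt0 ik)).
apply: lt_le_trans (S_trans i j k).
by rewrite mulr_gt0 ?S_offdiag_gt0 // eq_sym.
Qed.

Lemma cross_ratio_ge1 i j : (1 < n)%N -> 1 <= cross_ratio i j.
Proof.
move=> n_gt1; have [->|ij] := eqVneq i j; first by rewrite cross_ratio_diag.
by rewrite ler_pdivlMr ?offdiag_mul_gt0 // mul1r S_trans.
Qed.

Lemma cross_ratio_submul i j k : (1 < n)%N ->
  cross_ratio k i <= cross_ratio i j * cross_ratio j k.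
Proof.
(* Positivity is given only off the diagonal, so coinciding indices are treated apart: some ratio is
   then 1. *)
move=> n_gt1; have [->|ij] := eqVneq i j.
  by rewrite cross_ratio_diag // mul1r cross_ratioC.
have [->|jk] := eqVneq j k.
  by rewrite cross_ratio_diag // mulr1 cross_ratioC.
have [->|ki] := eqVneq k i.
  by rewrite cross_ratio_diag // mulr_ege1 ?cross_ratio_ge1.
have kj : k != j by rewrite eq_sym.
have ji : j != i by rewrite eq_sym.
have ik : i != k by rewrite eq_sym.
have prod_le : S i j * S j k * (S k j * S j i) <=
    S i k * S j j * (S k i * S j j).
  by apply: ler_pM; rewrite ?S_trans // mulr_ge0 // ltW ?S_offdiag_gt0.
rewrite /cross_ratio mulf_div ler_pdivlMr; last first.
  by rewrite mulr_gt0 ?offdiag_mul_gt0.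
rewrite mulrAC ler_pdivrMr ?offdiag_mul_gt0 //.
(* Clearing denominators leaves [prod_le] times this factor; its sign comes from the pair [k], [i],
   not from single diagonal entries. *)
have diag_ge0 : 0 <= S k k * S i i.
  by apply: ltW; apply: lt_le_trans (S_trans k i k); rewrite offdiag_mul_gt0.
have := ler_wpM2l diag_ge0 prod_le.
by congr (_ <= _); ring.
Qed.

End TransitionInequality.

Lemma trivial_path_avoids (R : realType) (n : nat) (G : digraph R n)
  (i j : 'I_n) : i != j -> ~ every_path_contains G i j i.
Proof.
move=> ij /(_ [::]); rewrite /directed_path /= eqxx inE => /(_ isT).
by rewrite eq_sym (negPf ij).
Qed.

(* For n > 2 the diagonal of S is automatically positive, so H is defined.
   For n = 2 both diagonal entries may be negative; then the quotient formula
   for D still makes sense (and the result still holds), but h_ii = ln s_ii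
   does not exist, hence the proviso on the formula through H. *)
Theorem theorem1 (R : realType) (n : nat) (n_gt1 : (1 < n)%N)
    (G : digraph R n) (S : 'M[R]_n)
    (S_measure : transitional_measure G S)
    (S_offdiag_gt0 : forall i j : 'I_n, i != j -> 0 < S i j) :
  let H : 'M[R]_n := map_mx (@ln R) S in
  let D : 'M[R]_n :=
    \matrix_(i, j) (2^-1 * ln (S i i * S j j / (S i j * S j i))) in
  distance_matrix D /\
  ((n = 2%N -> forall i : 'I_n, 0 < S i i) ->
   D = \matrix_(i, j) (2^-1 * (H i i + H j j - H i j - H j i))).
Proof.
move=> H D; have [S_trans S_bottleneck] := S_measure.
have DE i j : D i j = 2^-1 * ln (cross_ratio S i j) by rewrite mxE.
have half_gt0 : 0 < 2^-1 :> R by rewrite invr_gt0.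
have q_ge1 i j : 1 <= cross_ratio S i j by exact: cross_ratio_ge1.
have q_gt0 i j : 0 < cross_ratio S i j := lt_le_trans ltr01 (q_ge1 i j).
split.
  split=> [i j|i j k|i j|i j]; rewrite !DE.
  - split=> [/eqP|->]; last by rewrite cross_ratio_diag // ln1 mulr0.
    rewrite mulf_eq0 gt_eqF //= ln_eq0 // => /eqP q1.
    apply/eqP/negPn/negP => ij; apply: (trivial_path_avoids (G := G) ij).
    (* A ratio of 1 is exactly the equality case of the bottleneck identity at [(i, j, i)]. *)
    apply/S_bottleneck; rewrite -[LHS]mul1r -q1 divfK //.
    by rewrite gt_eqF // offdiag_mul_gt0.
  - rewrite -mulrDr ler_pM2l // -lnM ?posrE //.
    rewrite ler_ln ?posrE //; last exact: mulr_gt0 (q_gt0 _ _) (q_gt0 _ _).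
    exact: cross_ratio_submul.
  - by rewrite cross_ratioC.
  - by rewrite mulr_ge0 ?ln_ge0 // ltW.
move=> diag2; have diag_pos i : 0 < S i i.
  move: n_gt1; rewrite leq_eqVlt => /predU1P[n2|n_gt2]; first exact: diag2.
  exact: diag_gt0.
(* Splitting the logarithm of the quotient needs each entry positive, not just the products. *)
have S_gt0 i j : 0 < S i j.
  by have [->|/S_offdiag_gt0] := eqVneq i j.
apply/matrixP => i j; rewrite !mxE ln_div ?posrE ?mulr_gt0 //.
by rewrite !lnM ?posrE // opprD addrA.
Qed.
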